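(* Let $A,B,C$ be finite sets. If $\lambda \in \mathrm{Exch}(2^A, 2^B)$ and $\mu \in \mathrm{Exch}(2^B, 2^C)$, then $\lambda \circ \mu \in \mathrm{Exch}(2^A, 2^C)$.
   Context: For a finite set $E$, $2^E$ is the set of subsets of $E$. Complements $\overline X$ are taken in the ambient set ($\overline X = A\setminus X$ for $X\subseteq A$, $\overline Y = B \setminus Y$ for $Y \subseteq B$). $A\sqcup B$ is the disjoint union (in particular $A$ and $B$ are treated as disjoint inside $A \sqcup B$ even if $A=B$), and subsets of $A \sqcup B$ are identified with pairs of subsets of $A$ and $B$. $\mathrm{Rel}(2^A,2^B)$ is the set of all binary relations $\lambda \subseteq 2^A\times 2^B$ (including the empty relation); $X\mapsto_\lambda Y$ means $(X,Y)\in\lambda$. Composition is in diagrammatic order: $X\mapsto_{\lambda\circ\mu} Z$ iff there is $Y \in 2^B$ with $X\mapsto_\lambda Y$ and $Y\mapsto_\mu Z$. Given $X\mapsto_\lambda Y$ and $u,v\in A\sqcup B$, say $u$ and $v$ are exchangeable in $X\mapsto_\lambda Y$ if either $u=v$, or exactly one of $u,v$ belongs to $\overline X\sqcup Y$ and $X'\mapsto_\lambda Y'$, where $X' = X\,\triangle\,(\{u,v\}\cap A)$ and $Y'=Y\,\triangle\,(\{u,v\}\cap B)$ ($\triangle$ is symmetric difference). $\lambda\in \mathrm{Rel}(2^A,2^B)$ satisfies the exchange axiom if for all $X\mapsto_\lambda Y$, $X'\mapsto_\lambda Y'$ and all $u\in\overline X\sqcup Y$ there exists $v\in\overline{X'}\sqcup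 Y'$ such that $u$ and $v$ are exchangeable in $X\mapsto_\lambda Y$. $\mathrm{Exch}(2^A,2^B)$ is the set of all relations in $\mathrm{Rel}(2^A,2^B)$ satisfying the exchange axiom (the empty relation is included). Equivalently, $\{\overline X\sqcup Y : X\mapsto_\lambda Y\}$ is either empty or the set of bases of a matroid on $A\sqcup B$. *)

(* Defs.v *)
From mathcomp Require Import all_boot.

Set Implicit Arguments.
Unset Strict Implicit.
Unset Printing Implicit Defensive.

(* Rel(2^A, 2^B): all binary relations between 2^A and 2^B, as sets of pairs. *)
Definition Rel (A B : finType) := {set {set A} * {set B}}.

(* Diagrammatic order: first [l], then [m]. *)
Definition rcomp (A B C : finType) (l : Rel A B) (m : Rel B C) : Rel A C :=
  [set p | [exists Y : {set B}, ((p.1, Y) \in l) && ((Y, p.2) \in m)]].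

Definition symdiff (T : finType) (X Y : {set T}) : {set T} :=
  (X :\: Y) :|: (Y :\: X).

(* The subset of the disjoint union A + B corresponding to the pair (X, Y);
   the sum type keeps A and B disjoint even when A = B. *)
Definition dunion (A B : finType) (X : {set A}) (Y : {set B}) : {set A + B} :=
  (inl @: X) :|: (inr @: Y).

(* [inl @^-1: [set u; v]] is {u, v} :&: A, and [inr @^-1: [set u; v]] is
   {u, v} :&: B; [(+)] is exclusive or, so "exactly one of u, v". *)
Definition exchangeable (A B : finType) (l : Rel A B)
    (X : {set A}) (Y : {set B}) (u v : A + B) : Prop :=
  u = v \/
  ((u \in dunion (~: X) Y) (+) (v \in dunion (~: X) Y)) /\
  (symdiff X (inl @^-1: [set u; v]), symdiff Y (inr @^-1: [set u; v])) \in l.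

Definition exchange_axiom (A B : finType) (l : Rel A B) : Prop :=
  forall (X : {set A}) (Y : {set B}) (X' : {set A}) (Y' : {set B}),
    (X, Y) \in l -> (X', Y') \in l ->
    forall u : A + B, u \in dunion (~: X) Y ->
    exists2 v : A + B, v \in dunion (~: X') Y' & exchangeable l X Y u v.

(* Exch(2^A, 2^B), as a predicate on Rel(2^A, 2^B). *)
Definition Exch (A B : finType) (l : Rel A B) : Prop := exchange_axiom l.

(* Main.v *)
Require Import Defs.
From mathcomp Require Import all_boot.

(** Encode a pair (X, Y) by the set ~X + Y, so that Exch becomes basis
    exchange.  Place the bases of [l] and [m] in A + B + C: then D is a basis
    of the composite iff D + B is the union of disjoint bases P of [l] and Q
    of [m].  It remains to exchange u in P + Q against some v in P' + Q'.
    Exchanging u in P brings in an element x of P'; if x is not in Q we are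
    done, and otherwise x, which is not in Q', must in turn be exchanged in Q,
    and so on.  Each step enlarges #|P & P'| + #|Q & Q'|, so this stops. *)

Set Implicit Arguments.
Unset Strict Implicit.
Unset Printing Implicit Defensive.

(** * Exchange in unions of two disjoint bases *)

Definition basis_exchange (T : finType) (M : {set {set T}}) : Prop :=
  forall P P', P \in M -> P' \in M -> forall u, u \in P :\: P' ->
  exists2 v, v \in P' :\: P & v |: (P :\ u) \in M.

Lemma imsetD1 (S T : finType) (f : S -> T) (D : {set S}) (x : S) :
  injective f -> f @: (D :\ x) = f @: D :\ f x.
Proof.
move=> f_inj; apply/setP=> z; rewrite in_setD1; apply/imsetP/andP.
  by move=> [y /setD1P[yx yD] ->]; rewrite (inj_eq f_inj) imset_f.
move=> [zx /imsetP[y yD zE]]; exists y => //.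
by rewrite !inE yD -(inj_eq f_inj) -zE zx.
Qed.

Lemma disjointsU1 (T : finType) (x : T) (P Q : {set T}) :
  [disjoint x |: P & Q] = (x \notin Q) && [disjoint P & Q].
Proof. by rewrite !disjoints_subset subUset sub1set inE. Qed.

Lemma basis_exchange_imset (S T : finType) (f : S -> T) (M : {set {set S}}) :
  injective f -> basis_exchange M ->
  basis_exchange [set f @: (D : {set S}) | D in M].
Proof.
move=> f_inj exM _ _ /imsetP[P PM ->] /imsetP[P' P'M ->] _ /setDP[/imsetP[u uP ->]].
rewrite mem_imset // => uP'.
have [|v /setDP[vP' vP] vM] := exM P P' PM P'M u; first by rewrite inE uP uP'.
exists (f v); first by rewrite inE !mem_imset ?vP' ?vP.
rewrite (_ : _ |: _ = f @: (v |: (P :\ u))); first exact: imset_f.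
by rewrite imsetU1 imsetD1.
Qed.

(* [w] is the element currently to be exchanged in [P]; it may also lie in
   [Q], having been brought into [P] from there. *)
Lemma basis_exchange_chain (T : finType) (M N : {set {set T}})
    (P P' Q Q' E : {set T}) (w : T) :
  basis_exchange M -> basis_exchange N ->
  P \in M -> P' \in M -> Q \in N -> Q' \in N -> [disjoint P' & Q'] ->
  w \in P :\: P' -> [disjoint P :\ w & Q] -> (P :\ w) :|: Q = E ->
  exists v P2 Q2, [/\ v \in (P' :|: Q') :\: E, P2 \in M, Q2 \in N,
    [disjoint P2 & Q2] & P2 :|: Q2 = v |: E].
Proof.
(* [P'] and [Q'] stay fixed, so growing overlaps mean that these differences shrink. The sum is
   symmetric, as the two families trade places at each step. *)
have [n] := ubnP (#|P' :\: P| + #|Q' :\: Q|).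
elim: n M N P P' Q Q' w => // n IHn M N P P' Q Q' w le_n exM exN PM P'M QN Q'N.
move=> dP'Q' wP dPQ defE.
have [x xP' P2M] := exM P P' PM P'M w wP.
have [xE|xE] := boolP (x \in E); last first.
  exists x, (x |: (P :\ w)), Q; split=> //.
  - by move: xP'; rewrite !inE xE => /andP[_ ->].
  - by rewrite disjointsU1 dPQ andbT; apply: contra xE => xQ; rewrite -defE inE xQ orbT.
  - by rewrite -setUA defE.
have [/setDP[wP0 wP'] /setDP[xP'0 xP]] := (wP, xP').
(* [x] differs from every element of [P], so within [E] it can only come from [Q]. *)
have xQ : x \in Q by move: xE; rewrite -defE !inE (negPf xP) andbF.
have xQ' : x \notin Q' by rewrite (disjointFr dP'Q').
(* The families swap roles: [x] now lies in both current bases and must leave [Q]. Removing that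
   duplicate leaves the union [E] unchanged. *)
have [|||||v [Q2 [P2 [vD Q2N P2M' d2 U2]]]] :=
  IHn N M Q Q' (x |: (P :\ w)) P' x _ exN exM QN Q'N P2M P'M.
(* Giving up [w] costs nothing, since it is outside [P'], while [x] in [P'] is gained. *)
- rewrite -ltnS (leq_trans _ le_n) // ltnS addnC ltn_add2r proper_card //.
  apply/properP; split.
    apply/subsetP=> y; rewrite !inE.
    by case: (y =P w) => [->|_]; [rewrite (negPf wP') !andbF | case: (y == x) (y \in P) => [] []].
  by exists x; rewrite // !inE eqxx.
- by rewrite disjoint_sym.
- by rewrite inE xQ' xQ.
- rewrite disjoint_sym disjointsU1 !inE eqxx /=.
  by apply: disjointWr dPQ; apply: subD1set.
- by rewrite setUCA setUA setD1K // setUC.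
- by exists v, P2, Q2; split; rewrite // 1?disjoint_sym // 1?setUC // [P' :|: _]setUC.
Qed.

(** The exchange property of a matroid union, for pairs of disjoint bases. By symmetry [u] lies in
    [P], and the chain starts there with [w] equal to [u]. *)
Lemma union_exchange (T : finType) (M N : {set {set T}})
    (P P' Q Q' : {set T}) (u : T) :
  basis_exchange M -> basis_exchange N ->
  P \in M -> P' \in M -> Q \in N -> Q' \in N ->
  [disjoint P & Q] -> [disjoint P' & Q'] -> u \in (P :|: Q) :\: (P' :|: Q') ->
  exists v P2 Q2, [/\ v \in (P' :|: Q') :\: (P :|: Q), P2 \in M, Q2 \in N,
    [disjoint P2 & Q2] & P2 :|: Q2 = v |: ((P :|: Q) :\ u)].
Proof.
wlog uP : M N P P' Q Q' / u \in P.
  move=> IH exM exN PM P'M QN Q'N dPQ dPQ' uD.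
  have [uP|uP] := boolP (u \in P); first exact: IH.
  have uQ : u \in Q by move: uD; rewrite !inE (negPf uP) => /andP[].
  have [||//|v [Q2 [P2 [vD Q2N P2M d2 U2]]]] :=
    IH N M Q Q' P P' uQ exN exM QN Q'N PM P'M.
  - by rewrite disjoint_sym.
  - by rewrite disjoint_sym.
  - by rewrite ![Q :|: _]setUC ![Q' :|: _]setUC.
  by exists v, P2, Q2; split; rewrite // 1?disjoint_sym // setUC ?U2 // ![_ :|: Q]setUC ?[_ :|: Q']setUC.
move=> exM exN PM P'M QN Q'N dPQ dPQ' /setDP[_ uD'].
have uQ : u \notin Q by rewrite (disjointFr dPQ).
have [|||v [P2 [Q2 [vD P2M Q2N d2 U2]]]] :=
  @basis_exchange_chain _ M N P P' Q Q' ((P :|: Q) :\ u) u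
    exM exN PM P'M QN Q'N dPQ'.
- by move: uD'; rewrite !inE uP negb_or => /andP[->].
- by apply: disjointWl dPQ; apply: subD1set.
- by apply/setP=> y; rewrite !inE; case: eqP => // ->; rewrite (negPf uQ).
exists v, P2, Q2; split=> //.
(* The chain only keeps [v] out of the union without [u]; [v = u] is excluded because [u] is not in
   [P' :|: Q']. *)
move: vD; rewrite !inE negb_and negbK => /andP[/orP[/eqP eq_vu|->] vD'] //.
by move: uD'; rewrite -eq_vu inE vD'.
Qed.

(** * Relations as families of bases *)

Section Bases.
Variables (A B : finType) (l : Rel A B).

(** Stated by decoding [D] into a pair, so that membership unfolds directly to membership in [l]. *)
Definition bases : {set {set A + B}} :=
  [set D : {set A + B} | (~: (inl @^-1: D), inr @^-1: D) \in l].

Lemma mem_dunion (X : {set A}) (Y : {set B}) (u : A + B) :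
  (u \in dunion X Y) = match u with inl a => a \in X | inr b => b \in Y end.
Proof.
rewrite inE; case: u => [a|b].
  rewrite mem_imset; last by move=> ? ? [].
  by rewrite orbC; case: imsetP => // -[].
rewrite [X in _ || X]mem_imset; last by move=> ? ? [].
by case: imsetP => // -[].
Qed.

Lemma dunion_preim (D : {set A + B}) :
  dunion (~: (~: (inl @^-1: D))) (inr @^-1: D) = D.
Proof. by apply/setP=> -[a|b]; rewrite mem_dunion ?setCK inE. Qed.

Lemma preiml_dunion (X : {set A}) (Y : {set B}) : inl @^-1: dunion X Y = X.
Proof. by apply/setP=> x; rewrite in_set mem_dunion. Qed.

Lemma preimr_dunion (X : {set A}) (Y : {set B}) : inr @^-1: dunion X Y = Y.
Proof. by apply/setP=> x; rewrite in_set mem_dunion. Qed.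

Lemma dunion_bases (X : {set A}) (Y : {set B}) :
  (dunion (~: X) Y \in bases) = ((X, Y) \in l).
Proof. by rewrite in_set preiml_dunion preimr_dunion setCK. Qed.

(** Replacing [u] by [v] is the symmetric difference with [[set u; v]], and on the A side this
    commutes with the complement. *)
Lemma exchange_bases (D : {set A + B}) (u v : A + B) :
  u \in D -> v \notin D ->
  (v |: (D :\ u) \in bases) =
  ((symdiff (~: (inl @^-1: D)) (inl @^-1: [set u; v]),
    symdiff (inr @^-1: D) (inr @^-1: [set u; v])) \in l).
Proof.
move=> uD vD.
have inU y : (y \in v |: (D :\ u)) = ((y \in D) (+) ((y == u) || (y == v))).
  rewrite !inE; case: (eqVneq y u) => [->|_]; case: eqP => [->|_] //=;
    by rewrite ?uD ?(negPf vD) ?addbF.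
rewrite in_set; congr ((_, _) \in l); apply/setP=> y.
  by rewrite in_setC in_set inU !inE; case: (_ \in D); case: (_ || _).
by rewrite in_set inU !inE; case: (_ \in D); case: (_ || _).
Qed.

(** The exchange axiom also treats [u] in [D'], where [v = u] serves. For [u] outside [D'], a [v] in
    [D'] differs from [u], and the exclusive or puts it outside [D]. *)
Lemma ExchP : Exch l <-> basis_exchange bases.
Proof.
split=> [exl D D' DM D'M u /setDP[uD uD']|exM X Y X' Y' XY XY' u uD].
  have := DM; have := D'M; rewrite !inE => D'l Dl.
  have [|v] := exl _ _ _ _ Dl D'l u; first by rewrite dunion_preim.
  rewrite /exchangeable !dunion_preim => vD' [uv|[]].
    by rewrite uv vD' in uD'.
  rewrite uD /= => vD; rewrite -exchange_bases // => vM.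
  by exists v; rewrite // inE vD vD'.
move: XY XY'; rewrite -!dunion_bases => DM D'M.
have [uD'|uD'] := boolP (u \in dunion (~: X') Y'); first by exists u; [|left].
have [|v /setDP[vD' vD]] := exM _ _ DM D'M u; first by rewrite inE uD uD'.
rewrite exchange_bases // preiml_dunion preimr_dunion setCK => vl.
by exists v => //; right; rewrite uD (negPf vD).
Qed.

End Bases.

(** * Composition inside A + B + C *)

Section Composition.
Variables (A B C : finType) (l : Rel A B) (m : Rel B C).

Definition emb_l (x : A + B) : A + (B + C) :=
  match x with inl a => inl a | inr b => inr (inl b) end.
Definition emb_m (x : B + C) : A + (B + C) := inr x.
Definition emb_lm (x : A + C) : A + (B + C) :=
  match x with inl a => inl a | inr c => inr (inr c) end.
Definition middle : {set A + (B + C)} := [set inr (inl b) | b in B].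

Lemma emb_l_inj : injective emb_l.
Proof. by move=> [a|b] [a'|b'] //= [->]. Qed.

Lemma emb_m_inj : injective emb_m.
Proof. by move=> x y []. Qed.

Lemma emb_lm_inj : injective emb_lm.
Proof. by move=> [a|b] [a'|b'] //= [->]. Qed.

Lemma mem_emb_l (D : {set A + B}) x :
  (x \in emb_l @: D) = match x with
    inl a => inl a \in D | inr (inl b) => inr b \in D | _ => false end.
Proof.
case: x => [a|[b|c]]; last by apply/imsetP => -[[]].
- by rewrite -(mem_imset _ _ emb_l_inj).
- by rewrite -(mem_imset _ _ emb_l_inj).
Qed.

Lemma mem_emb_m (D : {set B + C}) x :
  (x \in emb_m @: D) = if x is inr y then y \in D else false.
Proof.
case: x => [a|y]; first by apply/imsetP => -[].
by rewrite -(mem_imset _ _ emb_m_inj).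
Qed.

Lemma mem_emb_lm (D : {set A + C}) x :
  (x \in emb_lm @: D :|: middle) = match x with
    inl a => inl a \in D | inr (inl b) => true | inr (inr c) => inr c \in D end.
Proof.
rewrite inE; case: x => [a|[b|c]]; last 1 first.
- rewrite -(mem_imset _ _ emb_lm_inj) [X in _ || X](_ : _ = false) ?orbF //.
  by apply/imsetP => -[].
- rewrite -(mem_imset _ _ emb_lm_inj) [X in _ || X](_ : _ = false) ?orbF //.
  by apply/imsetP => -[].
- by rewrite orbC imset_f.
Qed.

(** On B, a basis of [l] has trace [Y] and a basis of [m] has trace [~: Y]. Hence the two use the
    same [Y] exactly when their traces are disjoint and cover [middle]; the A and C parts never
    meet. *)
Lemma bases_rcompP (D : {set A + C}) :
  reflect (exists P Q, [/\ P \in [set emb_l @: (F : {set _}) | F in bases l],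
      Q \in [set emb_m @: (F : {set _}) | F in bases m],
      [disjoint P & Q] & P :|: Q = emb_lm @: D :|: middle])
    (D \in bases (rcomp l m)).
Proof.
rewrite !inE; apply: (iffP existsP) => [[Y /andP[lY mY]]|].
  exists (emb_l @: dunion (~: (~: (inl @^-1: D))) Y),
         (emb_m @: dunion (~: Y) (inr @^-1: D)).
  split; first by rewrite imset_f // dunion_bases.
  - by rewrite imset_f // dunion_bases.
  - rewrite -setI_eq0; apply/eqP/setP=> -[a|[b|c]];
      by rewrite !inE mem_emb_l mem_emb_m ?mem_dunion ?inE ?andbF ?andbN.
  - apply/setP=> -[a|[b|c]]; rewrite inE mem_emb_l mem_emb_m mem_emb_lm ?mem_dunion;
      by rewrite ?inE ?negbK ?orbF ?orbN.
move=> [_ [_ [/imsetP[P PM ->] /imsetP[Q QM ->] dPQ /setP eqD]]].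
have eqa a : (inl a \in D) = (inl a \in P).
  by have := eqD (inl a); rewrite inE mem_emb_l mem_emb_m mem_emb_lm orbF.
have eqc c : (inr c \in D) = (inr c \in Q).
  by have := eqD (inr (inr c)); rewrite inE mem_emb_l mem_emb_m mem_emb_lm.
have eqb b : (inl b \in Q) = (inr b \notin P).
  have := eqD (inr (inl b)); rewrite inE mem_emb_l mem_emb_m mem_emb_lm.
  have := disjointFr dPQ (x := inr (inl b)); rewrite mem_emb_l mem_emb_m.
  by case: (_ \in P) => [->|_].
exists (inr @^-1: P); move: PM QM; rewrite !inE => PM QM; apply/andP; split.
  move: PM; congr ((_, _) \in l); apply/setP=> y; by rewrite !inE eqa.
move: QM; congr ((_, _) \in m); apply/setP=> y; by rewrite !inE ?eqb ?eqc ?negbK.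
Qed.

(** Both unions contain all of [middle], which therefore cancels from their differences and leaves
    an exchange within A + C. *)
Lemma bases_rcomp_exchange :
  basis_exchange (bases l) -> basis_exchange (bases m) ->
  basis_exchange (bases (rcomp l m)).
Proof.
move=> /(basis_exchange_imset emb_l_inj) exl.
move=> /(basis_exchange_imset emb_m_inj) exm D D'.
move=> /bases_rcompP[P [Q [PM QN dPQ defD]]].
move=> /bases_rcompP[P' [Q' [P'M Q'N dPQ' defD']]] u uDD'.
have mid (E : {set A + C}) w : (emb_lm w \in emb_lm @: E :|: middle) = (w \in E).
  by rewrite mem_emb_lm; case: w.
have [|v] := union_exchange (u := emb_lm u) exl exm PM P'M QN Q'N dPQ dPQ'.
  by move: uDD'; rewrite defD defD' !in_setD !mid.
rewrite defD defD' => -[P2 [Q2 [vD P2M Q2N d2 U2]]].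
(* [v] avoids a union containing the whole copy of B. *)
have [v0 defv] : exists v0, v = emb_lm v0.
  move: vD; rewrite in_setD !mem_emb_lm.
  by case: v {U2} => [a|[b|c]] // _; [exists (inl a) | exists (inr c)].
rewrite {}defv in vD U2; exists v0; first by rewrite in_setD !mid in_setD in vD *.
apply/bases_rcompP; exists P2, Q2; split; rewrite // U2.
rewrite imsetU1 imsetD1; last exact: emb_lm_inj.
(* Removing [emb_lm u] does not affect [middle], which is disjoint from the image of [emb_lm]. *)
rewrite -setUA setDUl; congr (_ :|: (_ :|: _)).
apply/setP=> x; rewrite !inE; case: eqP => // ->.
by case: u {uDD' U2} => [a|c]; apply/esym/imsetP => -[].
Qed.

End Composition.

Theorem theorem2p15 (A B C : finType) (l : Rel A B) (m : Rel B C) :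
  Exch l -> Exch m -> Exch (rcomp l m).
Proof.
by move=> /ExchP exl /ExchP exm; apply/ExchP/bases_rcomp_exchange.
Qed.
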